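(* Let $0<\alpha<1$, $l,T>0$, integers $N,M\ge2$, $h=l/N$, $x_i=ih$, $\tau=T/M$, $t_j=j\tau$. Let $k(t)\ge c_1>0$ and $q(t)\ge0$ be given functions of $t$ only, $a^{j+1}=k(t_{j+1})$, $d^{j+1}=q(t_{j+1})$, and let $\varphi_i^{j+1}$ be given grid data. Consider the compact difference scheme $$\Delta_{0t_{j+1}}^{\alpha}\mathcal{H}_hy_i=a^{j+1}y_{\bar xx,i}^{j+1}-d^{j+1}\mathcal{H}_hy_i^{j+1}+\mathcal{H}_h\varphi_i^{j+1},\quad i=1,\dots,N-1,\ j=1,\dots,M-1,$$ $$y_0^j=y_N^j=0\ (j=0,\dots,M),\qquad y_i^0=u_0(x_i)\ (i=0,\dots,N),$$ with $y^1$ given. Then the scheme is unconditionally stable, and its solution satisfies $$\sum_{j=1}^{M-1}\left(\|\mathcal{H}_hy^{j+1}\|_0^2+\|y_{\bar x}^{j+1}]|_0^2\right)\tau\le M_2\left(\|\mathcal{H}_hy^1\|_0^2+\|\mathcal{H}_hy^0\|_0^2+\sum_{j=1}^{M-1}\|\mathcal{H}_h\varphi^{j+1}\|_0^2\tau\right),$$ where $M_2>0$ is a number independent of $h$ and $\tau$.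
   Context: Notation: $y_i^j$ is the value at $(x_i,t_j)$; $y_{\bar x,i}=(y_i-y_{i-1})/h$; $y_{\bar xx,i}=(y_{i+1}-2y_i+y_{i-1})/h^2$; $\mathcal{H}_hv_i=v_i+\frac{h^2}{12}v_{\bar xx,i}$ for $i=1,\dots,N-1$; $\|y\|_0^2=\sum_{i=1}^{N-1}y_i^2h$; $\|y]|_0^2=\sum_{i=1}^{N}y_i^2h$. The L2 operator acting on a grid function $w$ is $\Delta_{0t_{j+1}}^{\alpha}w_i=\frac{\tau^{-\alpha}}{\Gamma(2-\alpha)}\sum_{s=0}^{j}c_{j-s}^{(\alpha)}(w_i^{s+1}-w_i^s)$, with $a_l^{(\alpha)}=(l+1)^{1-\alpha}-l^{1-\alpha}$, $b_l^{(\alpha)}=\frac{1}{2-\alpha}[(l+1)^{2-\alpha}-l^{2-\alpha}]-\frac12[(l+1)^{1-\alpha}+l^{1-\alpha}]$ and the $j$-dependent coefficients: for $j=1$: $c_0^{(\alpha)}=a_0^{(\alpha)}+b_0^{(\alpha)}+b_1^{(\alpha)}$, $c_1^{(\alpha)}=a_1^{(\alpha)}-b_1^{(\alpha)}-b_0^{(\alpha)}$; for $j=2$: $c_0^{(\alpha)}=a_0^{(\alpha)}+b_0^{(\alpha)}$, $c_1^{(\alpha)}=a_1^{(\alpha)}+b_1^{(\alpha)}+b_2^{(\alpha)}-b_0^{(\alpha)}$, $c_2^{(\alpha)}=a_2^{(\alpha)}-b_2^{(\alpha)}-b_1^{(\alpha)}$; for $j\ge3$: $c_0^{(\alpha)}=a_0^{(\alpha)}+b_0^{(\alpha)}$,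 $c_s^{(\alpha)}=a_s^{(\alpha)}+b_s^{(\alpha)}-b_{s-1}^{(\alpha)}$ ($1\le s\le j-2$), $c_{j-1}^{(\alpha)}=a_{j-1}^{(\alpha)}+b_{j-1}^{(\alpha)}+b_j^{(\alpha)}-b_{j-2}^{(\alpha)}$, $c_j^{(\alpha)}=a_j^{(\alpha)}-b_j^{(\alpha)}-b_{j-1}^{(\alpha)}$. *)

(* Defs.v *)
From HB Require Import structures.
From mathcomp Require Import all_boot all_order all_algebra.
From mathcomp Require Import all_classical all_reals all_analysis.
Set Implicit Arguments. Unset Strict Implicit. Unset Printing Implicit Defensive.
Import Order.TTheory GRing.Theory Num.Theory.
Local Open Scope ring_scope.
Local Open Scope classical_set_scope.

Section Defs.
Variable R : realType.

Definition Gamma (x : R) : R :=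
  fine (\int[@lebesgue_measure R]_(t in `]0%R, +oo[) (powR t (x - 1) * expR (- t))%:E).

(* Grid functions: a time layer is v : nat -> R, v i = v_i;
   a space-time grid function is y : nat -> nat -> R with y j i = y_i^j. *)
Definition dxb (h : R) (v : nat -> R) (i : nat) : R := (v i - v i.-1) / h.
Definition dxx (h : R) (v : nat -> R) (i : nat) : R :=
  (v i.+1 - 2 * v i + v i.-1) / h ^+ 2.
Definition Hh (h : R) (v : nat -> R) (i : nat) : R := v i + h ^+ 2 / 12 * dxx h v i.

Definition norm0sq (N : nat) (h : R) (v : nat -> R) : R :=
  \sum_(1 <= i < N) v i ^+ 2 * h.
Definition norm0bsq (N : nat) (h : R) (v : nat -> R) : R :=
  \sum_(1 <= i < N.+1) v i ^+ 2 * h.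

Definition acoef (alpha : R) (l : nat) : R :=
  powR (l.+1%:R) (1 - alpha) - powR (l%:R) (1 - alpha).
Definition bcoef (alpha : R) (l : nat) : R :=
  (2 - alpha)^-1 * (powR (l.+1%:R) (2 - alpha) - powR (l%:R) (2 - alpha))
  - 2^-1 * (powR (l.+1%:R) (1 - alpha) + powR (l%:R) (1 - alpha)).

(* c_s^{(alpha)} for the layer index j (j >= 1), 0 <= s <= j *)
Definition ccoef (alpha : R) (j s : nat) : R :=
  let a := acoef alpha in let b := bcoef alpha in
  match j with
  | 1%N => if s == 0%N then a 0%N + b 0%N + b 1%N
           else a 1%N - b 1%N - b 0%N
  | 2%N => if s == 0%N then a 0%N + b 0%N
           else if s == 1%N then a 1%N + b 1%N + b 2%N - b 0%N
           else a 2%N - b 2%N - b 1%N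
  | _ => if s == 0%N then a 0%N + b 0%N
         else if (s <= j - 2)%N then a s + b s - b s.-1
         else if s == j.-1 then a j.-1 + b j.-1 + b j - b (j - 2)%N
         else a j - b j - b j.-1
  end.

Definition L2op (alpha tau : R) (w : nat -> nat -> R) (j i : nat) : R :=
  powR tau (- alpha) / Gamma (2 - alpha) *
  \sum_(0 <= s < j.+1) ccoef alpha j (j - s) * (w s.+1 i - w s i).

End Defs.

(* Main.v *)
(* Write delta_s = w^{s+1} - w^s and p = 1 - alpha. At layer j the L2 sum is
     sum_s d_{j-s} delta_s + b_0 (3 delta_j - delta_{j-1}) + b_j (delta_1 - 2 delta_0)
   with a nonnegative decreasing kernel d. Multiplied by w^{j+1}, the BDF2 part telescopes
   (G-stability), and the convolution with d dominates the increment of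
   1/2 sum_s d_{j-s} |w^{s+1}|^2. The Abel summation behind the latter leaves the squares
   d_j (w^{j+1} - w^0)^2 and (d_{j-2} - d_{j-1}) (w^{j+1} - w^2)^2, which absorb the last
   part because 2 b_j <= d_j and b_j <= d_{j-2} - d_{j-1}. Since d_1 + ... + d_{M-1} <= M^p,
   summing over the layers costs at most 4 M^p (|w^0|^2 + |w^1|^2), and the factor tau^p of
   the scheme turns M^p into T^p. The properties of d follow from
   0 <= b_s <= p (1-p) s^{p-2} / 12 for s >= 1 (trapezoidal error) and
   a_{s-1} - a_s >= p (1-p) s^{p-2} (second difference), except d_0 - d_1 >= b_2.

   In space, -(y_xx, H y) >= 2/3 |y_x|^2 and |H y|^2 <= l^2 |y_x|^2, so testing the scheme
   with H y^{j+1} and Young's inequality conclude. *)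

Require Import Defs.
From HB Require Import structures.
From mathcomp Require Import all_boot all_order all_algebra.
From mathcomp Require Import all_classical all_reals all_analysis.
From mathcomp Require Import ring lra zify.
Set Implicit Arguments. Unset Strict Implicit. Unset Printing Implicit Defensive.
Import Order.TTheory GRing.Theory Num.Theory.
Local Open Scope ring_scope.

(** * Calculus estimates for real powers *)

(** By the mean value theorem the sign of [g2] passes to [g1] and then to [g]; this stands in for
    Taylor's formula with remainder in the two estimates on powers below. *)
Lemma taylor2_ge0 (R : realType) (g g1 g2 : R -> R) :
  (forall u : R, 0 <= u <= 1 -> is_derive u 1 g (g1 u)) ->
  (forall u : R, 0 <= u <= 1 -> is_derive u 1 g1 (g2 u)) ->
  (forall u : R, 0 <= u <= 1 -> 0 <= g2 u) ->
  g 0 = 0 -> g1 0 = 0 -> 0 <= g 1.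
Proof.
have step (f df : R -> R) : (forall u : R, 0 <= u <= 1 -> is_derive u 1 f (df u)) ->
    (forall u : R, 0 <= u <= 1 -> 0 <= df u) -> f 0 = 0 ->
    forall u : R, 0 <= u <= 1 -> 0 <= f u.
  move=> fd df0 f0 u /andP[u0 u1].
  have [->|un0] := eqVneq u 0; first by rewrite f0.
  have up : 0 < u by rewrite lt_neqAle eq_sym un0.
  have [||c] := @MVT _ f df 0 u up.
  - by move=> x; rewrite in_itv /= => /andP[x0 xu]; apply: fd; lra.
  - apply: derivable_within_continuous => x; rewrite in_itv /= => xu.
    by have [] := fd x ltac:(lra).
  rewrite in_itv /= f0 !subr0 => /andP[c0 cu] ->.
  by apply: mulr_ge0 => //; apply: df0; lra.
move=> dg dg1 g2_ge0 g0 g10.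
apply: (step g g1) => //; last by rewrite ler01 lexx.
exact: (step g1 g2).
Qed.

Lemma is_derive_powR_shift (R : realType) (x c p u : R) : 0 < x + c * u ->
  is_derive u 1 (fun u : R => powR (x + c * u) p) (c * (p * powR (x + c * u) (p - 1))).
Proof.
move=> xu; pose h := fun u : R => x + c * u.
have dh : is_derive u 1 h c.
  by apply: is_derive_eq; rewrite /GRing.scale /=; ring.
have dp : is_derive (h u) 1 (fun y : R => powR y p) (p * powR (h u) (p - 1)).
  exact: is_derive1_powR.
have := @is_derive1_comp _ (fun y : R => powR y p) h u _ c dp dh.
by rewrite mulrC.
Qed.

(** The factor of [s] is the trapezoidal error for [t^p] on [[x, x + 1]]. With the right end moved
    to [x + u], its second derivative in [u] is [u/2 p (1-p) (x+u)^(p-2)], while the slack, taken as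
    [m u^3], adds [6 m u]. The signs [s = 1] and [s = -1] give lower and upper bounds of the
    error. *)
Lemma trapezoid_powR (R : realType) (x p s m : R) : 0 < x -> -1 < p ->
  (forall u : R, 0 <= u <= 1 ->
     0 <= s * (u / 2 * (p * (1 - p) * powR (x + 1 * u) (p - 1 - 1))) + 6 * m * u) ->
  0 <= s * ((p + 1)^-1 * (powR (x + 1) (p + 1) - powR x (p + 1))
            - 2^-1 * (powR (x + 1) p + powR x p)) + m.
Proof.
move=> x0 p0 sgn.
pose P (q u : R) := powR (x + 1 * u) q.
have dP (q u : R) : 0 <= u <= 1 -> is_derive u 1 (P q) (q * P (q - 1) u).
  by rewrite -[q * _]mul1r => u01; apply: is_derive_powR_shift; lra.
have P0 q : P q 0 = powR x q by rewrite /P mulr0 addr0.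
have P1 q : P q 1 = powR (x + 1) q by rewrite /P mulr1.
have {}sgn (u : R) : 0 <= u <= 1 ->
    0 <= s * (u / 2 * (p * (1 - p) * P (p - 1 - 1) u)) + 6 * m * u by exact: sgn.
have pn : p + 1 != 0 by rewrite gt_eqF //; lra.
rewrite -!P1 -!P0; clearbody P; clear P0 P1.
pose g (u : R) : R := s * ((p + 1)^-1 * (P (p + 1) u + - P (p + 1) 0)
            + - 2^-1 * (u ^+ 1 * (P p u + P p 0))) + m * u ^+ 3.
pose g1 (u : R) : R := s * (P p u + - 2^-1 * (P p u + P p 0) + - 2^-1 * (u ^+ 1 * (p * P (p - 1) u)))
            + 3 * m * u ^+ 2.
pose g2 (u : R) : R := s * (u / 2 * (p * (1 - p) * P (p - 1 - 1) u)) + 6 * m * u.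
have -> : s * ((p + 1)^-1 * (P (p + 1) 1 - P (p + 1) 0) - 2^-1 * (P p 1 + P p 0)) + m = g 1.
  by rewrite /g !expr1n !mulr1 mul1r mulNr.
have G1 : g 0 = 0.
  by rewrite /g subrr !expr0n /= !(mulr0, mul0r, addr0).
have G2 : g1 0 = 0.
  by rewrite /g1 !expr0n /=; field.
have G3 (u : R) : 0 <= u <= 1 -> 0 <= g2 u.
  by rewrite /g2; exact: sgn.
have D1 (u : R) : 0 <= u <= 1 -> is_derive u 1 g (g1 u).
  move=> u01; have d0 := dP p u u01; have := dP (p+1) u u01; rewrite addrK => d1.
  by apply: is_derive_eq; rewrite /GRing.scale /= /g1; field.
have D2 (u : R) : 0 <= u <= 1 -> is_derive u 1 g1 (g2 u).
  move=> u01; have d0 := dP p u u01; have d1 := dP (p - 1) u u01.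
  by apply: is_derive_eq; rewrite /GRing.scale /= /g2; field.
exact: (taylor2_ge0 D1 D2 G3 G1 G2).
Qed.

Lemma ler_powR_nexp (R : realType) (x y q : R) :
  0 < x -> x <= y -> q <= 0 -> powR y q <= powR x q.
Proof.
move=> x0 xy q0; have y0 : 0 < y by exact: lt_le_trans xy.
rewrite -[q]opprK !(powRN _ (- q)) lef_pV2 ?posrE ?powR_gt0 //.
by apply: ge0_ler_powR; rewrite ?nnegrE ?oppr_ge0 // ltW.
Qed.

(** Expand in [u] around [x]: the odd terms cancel, and convexity of [t^(p-2)] bounds its mean over
    [x - u] and [x + u] from below by its value at [x]. *)
Lemma second_difference_powR (R : realType) (x p : R) : 1 < x -> 0 < p -> p < 1 ->
  p * (1 - p) * powR x (p - 1 - 1) <= 2 * powR x p - powR (x - 1) p - powR (x + 1) p.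
Proof.
move=> x1 p0 p1.
pose P (q u : R) := powR (x + 1 * u) q.
pose N (q u : R) := powR (x + -1 * u) q.
have dP (q u : R) : 0 <= u <= 1 -> is_derive u 1 (P q) (q * P (q - 1) u).
  by rewrite -[q * _]mul1r => u01; apply: is_derive_powR_shift; lra.
have dN (q u : R) : 0 <= u <= 1 -> is_derive u 1 (N q) (- (q * N (q - 1) u)).
  by rewrite -[- (q * _)]mulN1r => u01; apply: is_derive_powR_shift; lra.
have P0 q : P q 0 = powR x q by rewrite /P mulr0 addr0.
have P1 q : P q 1 = powR (x + 1) q by rewrite /P mulr1.
have N0 q : N q 0 = powR x q by rewrite /N mulr0 addr0.
have N1 q : N q 1 = powR (x - 1) q by rewrite /N mulr1.
have conv (u : R) : 0 <= u <= 1 ->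
    2 * powR x (p - 1 - 1) <= P (p - 1 - 1) u + N (p - 1 - 1) u.
  move=> u01; rewrite /P /N mul1r mulN1r.
  have A0 := powR_ge0 (x + u) (p - 1 - 1); have B0 := powR_ge0 (x - u) (p - 1 - 1).
  have C0 := powR_ge0 x (p - 1 - 1).
  (* Since [(x + u) (x - u) <= x^2] and the exponent is negative, the geometric mean already
     dominates; the arithmetic mean is larger still. *)
  have : powR x (p - 1 - 1) * powR x (p - 1 - 1)
      <= powR (x + u) (p - 1 - 1) * powR (x - u) (p - 1 - 1).
    by rewrite -!powRM; [apply: ler_powR_nexp; nra|lra..].
  move=> AB; rewrite -(@ler_pXn2r _ 2) ?nnegrE ?addr_ge0 ?mulr_ge0 //.
  have := sqr_ge0 (powR (x + u) (p - 1 - 1) - powR (x - u) (p - 1 - 1)).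
  rewrite !expr2; nra.
set C := powR x (p - 1 - 1) in conv *.
rewrite -!P1 -!N1 -[powR x p]P0; have PN : N p 0 = P p 0 by rewrite P0 N0.
have PN1 : N (p - 1) 0 = P (p - 1) 0 by rewrite P0 N0.
clearbody P N C; clear P0 P1 N0 N1.
pose g (u : R) : R := 2 * P p 0 - N p u - P p u - p * (1 - p) * C * u ^+ 2.
pose g1 (u : R) : R := p * N (p - 1) u - p * P (p - 1) u - 2 * (p * (1 - p) * C) * u.
pose g2 (u : R) : R :=
  p * (1 - p) * N (p - 1 - 1) u + p * (1 - p) * P (p - 1 - 1) u - 2 * (p * (1 - p) * C).
have G1 : g 0 = 0 by rewrite /g !expr0n PN /=; ring.
have G2 : g1 0 = 0 by rewrite /g1 PN1; ring.
have G3 (u : R) : 0 <= u <= 1 -> 0 <= g2 u.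
  move=> u01; have -> : g2 u
      = p * (1 - p) * (P (p - 1 - 1) u + N (p - 1 - 1) u - 2 * C) by rewrite /g2; ring.
  by rewrite mulr_ge0 ?subr_ge0 ?conv // mulr_ge0; lra.
have D1 (u : R) : 0 <= u <= 1 -> is_derive u 1 g (g1 u).
  move=> u01; have d0 := dP p u u01; have d1 := dN p u u01.
  by apply: is_derive_eq; rewrite /GRing.scale /= /g1; ring.
have D2 (u : R) : 0 <= u <= 1 -> is_derive u 1 g1 (g2 u).
  move=> u01; have d0 := dP (p - 1) u u01; have d1 := dN (p - 1) u u01.
  by apply: is_derive_eq; rewrite /GRing.scale /= /g2; ring.
have := taylor2_ge0 D1 D2 G3 G1 G2.
by rewrite /g expr1n mulr1 subr_ge0.
Qed.

(** Bernoulli's inequality for exponents in [[0, 1]]: weighting [e1] by [1 - r] and [e2] by [r]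
    cancels [ln x]. *)
Lemma powR_le_affine (R : realType) (x r : R) : 0 < x -> 0 <= r <= 1 ->
  powR x r <= 1 + r * (x - 1).
Proof.
move=> x0 r01; rewrite /powR gt_eqF //; set w := expR _.
have w0 : 0 < w by exact: expR_gt0.
have e1 : w * (1 - r * ln x) <= 1.
  have E1 : w * expR (- (r * ln x)) = 1 by rewrite -expRD subrr expR0.
  rewrite -[leRHS]E1.
  by apply: ler_wpM2l; [exact: ltW|exact: expR_ge1Dx].
have e2 : w * (1 + (1 - r) * ln x) <= x.
  have E2 : w * expR ((1 - r) * ln x) = x.
    by rewrite -expRD -mulrDl addrC subrK mul1r lnK // posrE.
  rewrite -[leRHS]E2.
  by apply: ler_wpM2l; [exact: ltW|exact: expR_ge1Dx].
by nra.
Qed.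

(** * Bounds on the coefficients a and b *)

Lemma acoef0 (R : realType) (alpha : R) : alpha < 1 -> acoef alpha 0 = 1.
Proof. by move=> a1; rewrite /acoef powR1 powR0 ?subr0 // gt_eqF //; lra. Qed.

Lemma bcoef0 (R : realType) (alpha : R) : alpha < 1 ->
  bcoef alpha 0 = alpha / (2 * (2 - alpha)).
Proof.
move=> a1; have ? : 2 - alpha != 0 by rewrite gt_eqF //; lra.
rewrite /bcoef !powR1 !powR0; [by field|rewrite gt_eqF //; lra..].
Qed.

(** [bcoef] is the trapezoidal error for [t^(1-alpha)], and the rule underestimates the integral of
    a concave function. *)
Lemma bcoef_ge0 (R : realType) (alpha : R) (s : nat) : 0 < alpha -> alpha < 1 ->
  0 <= bcoef alpha s.+1.
Proof.
move=> a0 a1; have := @trapezoid_powR R s.+1%:R (1 - alpha) 1 0 (ltr0Sn _ _) ltac:(lra).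
rewrite mul1r addr0 natr1 (_ : 1 - alpha + 1 = 2 - alpha); last by ring.
apply=> u u01; rewrite mul1r mulr0 mul0r addr0.
by rewrite !mulr_ge0 ?powR_ge0 //; lra.
Qed.

(** The second derivative of [t^(1-alpha)] is largest in modulus at the left end of the cell; the 12
    is that of the classical trapezoidal error. *)
Lemma bcoef_le (R : realType) (alpha : R) (s : nat) : 0 < alpha -> alpha < 1 ->
  bcoef alpha s.+1 <= alpha * (1 - alpha) / 12 * powR s.+1%:R (- alpha - 1).
Proof.
move=> a0 a1; set m := leRHS.
have := @trapezoid_powR R s.+1%:R (1 - alpha) (-1) m (ltr0Sn _ _) ltac:(lra).
rewrite natr1 (_ : 1 - alpha + 1 = 2 - alpha); last by ring.
rewrite -/(bcoef alpha s.+1) => H.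
suff : 0 <= -1 * bcoef alpha s.+1 + m by lra.
apply: H => u u01.
rewrite (_ : 1 - alpha - 1 - 1 = - alpha - 1); last by ring.
have s0 : 0 < s.+1%:R :> R by rewrite ltr0Sn.
have : powR (s.+1%:R + 1 * u) (- alpha - 1) <= powR s.+1%:R (- alpha - 1).
  by apply: ler_powR_nexp; lra.
rewrite /m; set P := powR _ _; set Q := powR _ _ => PQ.
have -> : -1 * (u / 2 * ((1 - alpha) * (1 - (1 - alpha)) * P))
  + 6 * (alpha * (1 - alpha) / 12 * Q) * u
  = (1 - alpha) * alpha * (u / 2) * (Q - P) by field.
by rewrite !mulr_ge0 //; lra.
Qed.

(** An increment of a concave function is at least its slope at the right end; this is Bernoulli's
    inequality for the ratio of the two nodes. *)
Lemma acoef_ge (R : realType) (alpha : R) (s : nat) : 0 < alpha -> alpha < 1 ->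
  (1 - alpha) * powR s.+2%:R (- alpha) <= acoef alpha s.+1.
Proof.
move=> a0 a1; have s0 : 0 < s.+2%:R :> R by rewrite ltr0Sn.
have := @powR_le_affine R (s.+1%:R / s.+2%:R) (1 - alpha)
  ltac:(by rewrite divr_gt0 ?ltr0Sn) ltac:(lra).
have Y0 : 0 < powR (s.+2%:R : R) (1 - alpha) by rewrite powR_gt0.
have -> : powR (s.+1%:R / s.+2%:R) (1 - alpha)
    = powR (s.+1%:R : R) (1 - alpha) / powR (s.+2%:R : R) (1 - alpha).
  rewrite powRM ?invr_ge0 ?ler0n //; congr (_ * _).
  by rewrite -powR_inv1 ?ler0n // -powRrM mulN1r powRN.
rewrite ler_pdivrMr // /acoef.
have -> : powR s.+2%:R (- alpha) = powR s.+2%:R (1 - alpha) / s.+2%:R.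
  transitivity (powR (s.+2%:R : R) (1 - alpha - 1)); first by congr (powR _ _); ring.
  by rewrite powRB ?pnatr_eq0 ?implybT // powRr1 ?ler0n.
set X := powR s.+1%:R _; set Y := powR s.+2%:R _ => H.
have -> : (1 - alpha) * (Y / s.+2%:R) = Y - (1 + (1 - alpha) * (s.+1%:R / s.+2%:R - 1)) * Y.
  have : 0 < s.+1%:R :> R by rewrite ltr0Sn.
  by rewrite -[s.+2%:R]natr1; move: (s.+1%:R : R) => z z0; field; lra.
by rewrite lerB.
Qed.

Lemma acoef_diff (R : realType) (alpha : R) (s : nat) : 0 < alpha -> alpha < 1 ->
  alpha * (1 - alpha) * powR s.+2%:R (- alpha - 1) <= acoef alpha s.+1 - acoef alpha s.+2.
Proof.
move=> a0 a1; have := @second_difference_powR R s.+2%:R (1 - alpha)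
  ltac:(by rewrite ltr1n) ltac:(lra) ltac:(lra).
have E : s.+2%:R - 1 = s.+1%:R :> R by rewrite -[s.+2%:R]natr1 addrK.
rewrite natr1 E (_ : 1 - alpha - 1 - 1 = - alpha - 1); last by ring.
by rewrite /acoef; move: (powR _ _) (powR _ _) (powR _ _) (powR _ _) => A B C D; lra.
Qed.

(** * The decreasing kernel [dcoef] and the splitting of the L2 coefficients *)

(** Here [s + 3 <= 3 (s + 1)] and [3^(-alpha-1) >= 1/9]. *)
Lemma powR_shift2_le (R : realType) (alpha : R) (s : nat) : 0 < alpha -> alpha < 1 ->
  powR s.+1%:R (- alpha - 1) <= 9 * powR s.+3%:R (- alpha - 1).
Proof.
move=> a0 a1; have s0 : 0 < s.+1%:R :> R by rewrite ltr0Sn.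
have h1 : powR (3 * s.+1%:R) (- alpha - 1) <= powR s.+3%:R (- alpha - 1).
  by apply: ler_powR_nexp; [rewrite ltr0Sn|rewrite -natrM ler_nat; lia|lra].
rewrite powRM ?ler0n // in h1.
have h2 : 9^-1 <= powR 3 (- alpha - 1) :> R.
  have <- : powR 3 (- 2%:R) = 9^-1 :> R by rewrite powR_invn //; congr (_^-1); ring.
  by apply: ler_powR; lra.
have := powR_ge0 (s.+1%:R : R) (- alpha - 1); nra.
Qed.

Lemma pow3_bound (R : realType) (p : R) : 0 <= p <= 1 ->
  powR 3 p * (5 - p) <= 7 * p + 5.
Proof.
(* Equality holds at [p = 0] and [p = 1], so [3 ^ p] is bounded by its chords over
   the two halves of the interval. *)
move=> p01; pose v := Num.sqrt 3 : R.
have v0 : 0 <= v by exact: sqrtr_ge0.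
have v2 : v * v = 3 by rewrite -expr2 sqr_sqrtr.
have E3 r : powR 3 r = powR v (2 * r) by rewrite powRrM powR_mulrn // expr2 v2.
have [p2|p2] := lerP p (2^-1 : R).
  have := @powR_le_affine R v (2 * p) ltac:(nra) ltac:(lra).
  rewrite -E3; set P := powR _ _ => H.
  (* The number [1733/1000] lies just above the square root of 3. The slope [1466/1000] is
     [2 (1.733 - 1)]; in the other half, [2534/1000] is [2 (3 - 1.733)]. *)
  have v3 : v <= 1733 / 1000 by nra.
  have P3 : P <= 1 + p * (1466 / 1000) by nra.
  nra.
have := @powR_le_affine R v^-1 (2 * (1 - p)) ltac:(by rewrite invr_gt0; nra) ltac:(lra).
rewrite -powR_inv1 // -powRrM mulN1r powRN -E3 powRB ?pnatr_eq0 ?implybT // powRr1 //.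
rewrite invf_div powR_inv1 // ler_pdivrMr // => H.
have w : v^-1 = v / 3 by rewrite -v2; field; rewrite gt_eqF //; nra.
rewrite {}w in H.
have v3 : v <= 1733 / 1000 by nra.
move: H; set P := powR _ _ => H.
have P3 : P <= 3 - (1 - p) * (2534 / 1000) by nra.
nra.
Qed.

(* What is left of [c_s] once [b_0 (3 delta_j - delta_(j-1))], the BDF2 part, and the
   corrections in [b_j] at the two oldest layers have been removed; see [ccoef_dcoef]. *)
Definition dcoef (R : realType) (alpha : R) (s : nat) : R :=
  match s with
  | 0 => 1 - 2 * bcoef alpha 0
  | 1 => acoef alpha 1 + bcoef alpha 1
  | s'.+1 => acoef alpha s + bcoef alpha s - bcoef alpha s'
  end.

(** One formula for all layers. The first two layers are checked separately, because there the
    corrections at the newest and oldest steps overlap. *)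
Lemma ccoef_dcoef (R : realType) (alpha : R) (j s : nat) : alpha < 1 -> (s <= j.+1)%N ->
  ccoef alpha j.+1 s = dcoef alpha s
    + bcoef alpha 0 * (3 * (s == 0)%:R - (s == 1)%:R)
    + bcoef alpha j.+1 * ((s == j)%:R - 2 * (s == j.+1)%:R).
Proof.
move=> a1 sj; have A0 := acoef0 a1.
case: j sj => [|[|j]] sj; rewrite /ccoef.
- by case: s sj => [|[|s]] // _ /=; rewrite ?A0; ring.
- by case: s sj => [|[|[|s]]] // _ /=; rewrite ?A0; ring.
case: s sj => [|s] sj /=; first by rewrite A0 !mulr0; ring.
rewrite subn2 /=; case: ltnP => sj1.
  have -> : (s.+1 == j.+2)%N = false by lia.
  have -> : (s.+1 == j.+3)%N = false by lia.
  by case: s sj sj1 => [|s] _ _ /=; ring.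
have [e|sn] := eqVneq s.+1 j.+2.
  have -> : s = j.+1 by lia.
  by rewrite -[j.+2 == j.+3]/(j == j.+1) (ltn_eqF (ltnSn j)) /=; ring.
have -> : s = j.+2 by lia.
by rewrite eqxx /=; ring.
Qed.

Lemma dcoef_diff (R : realType) (alpha : R) (s : nat) : 0 < alpha -> alpha < 1 ->
  bcoef alpha s.+2 <= dcoef alpha s - dcoef alpha s.+1.
Proof.
move=> a0 a1; have aa : 0 < alpha * (1 - alpha) by nra.
case: s => [|[|s]] /=.
- (* Up to a positive factor this is [3 ^ p (5 - p) <= 7 p + 5] with [p = 1 - alpha]. *)
  rewrite bcoef0 // /acoef /bcoef powR1.
  have -> : powR (3%:R : R) (2 - alpha) = 3 * powR 3 (1 - alpha).
    by rewrite -(@mulr_powRB1 _ 3 (2 - alpha)) //; [congr (_ * powR _ _); ring|lra].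
  have := @pow3_bound R (1 - alpha) ltac:(lra).
  set X := powR 3 _; set Y := powR 2 (1 - alpha); set Z := powR 2 _ => H.
  rewrite -subr_ge0.
  have -> : 1 - 2 * (alpha / (2 * (2 - alpha))) - (Y - 1 + ((2 - alpha)^-1 * (Z - 1) - 2^-1 * (Y + 1)))
     - ((2 - alpha)^-1 * (3 * X - Z) - 2^-1 * (X + Y))
     = (2 * (2 - alpha))^-1 * (7 * (1 - alpha) + 5 - X * (5 - (1 - alpha))).
    by field; lra.
  by rewrite mulr_ge0 ?invr_ge0; lra.
- have := acoef_diff 0 a0 a1; have := bcoef_le 1 a0 a1; have := bcoef_le 2 a0 a1.
  have := bcoef_ge0 0 a0 a1.
  have : powR 3 (- alpha - 1) <= powR 2 (- alpha - 1) :> R by apply: ler_powR_nexp; lra.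
  have := powR_ge0 (2 : R) (- alpha - 1).
  by set X := powR 3 _; set Y := powR 2 _; nra.
(* In units of [alpha (1-alpha) (s+3)^(-alpha-1)], the difference of the a's is at least 1, while
   [b_(s+1)], [b_(s+3)] and [b_(s+4)] are at most 9/12, 1/12 and 1/12. *)
have := acoef_diff s.+1 a0 a1; have := bcoef_le s a0 a1.
have := bcoef_le s.+2 a0 a1; have := bcoef_le s.+3 a0 a1.
have := bcoef_ge0 s.+1 a0 a1; have := powR_shift2_le s a0 a1.
have : powR s.+4%:R (- alpha - 1) <= powR s.+3%:R (- alpha - 1) :> R.
  by apply: ler_powR_nexp; rewrite ?ltr0Sn ?ler_nat //; lra.
have := powR_ge0 (s.+3%:R : R) (- alpha - 1).
set X := powR s.+1%:R _; set Y := powR s.+3%:R _; set Z := powR s.+4%:R _.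
move: (alpha * (1 - alpha)) aa => k k0 Y0 ZY XY B2 B4 B3 B1 D.
have : k * Z <= k * Y by rewrite ler_pM2l.
have : k * X <= k * (9 * Y) by rewrite ler_pM2l.
have : 0 <= k * Y by rewrite mulr_ge0 // ltW.
have e (W : R) : k / 12 * W = (k * W) / 12 by ring.
have -> : k * (9 * Y) = 9 * (k * Y) by ring.
by move: B2 B4 B3 B1 D; rewrite !e; lra.
Qed.

(** The a's decay one power slower than the b's: [(t+2)^(-alpha)] is at least twice
    [(t+2)^(-alpha-1)]. In units of [(1-alpha) (s+3)^(-alpha-1)], for [s >= 1] at index [s + 1],
    this gives at least 2 shifted by one node, against at most 9/12 for each of the two b's. *)
Lemma dcoef_ge (R : realType) (alpha : R) (s : nat) : 0 < alpha -> alpha < 1 ->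
  2 * bcoef alpha s.+1 <= dcoef alpha s.+1.
Proof.
move=> a0 a1; have k1 : 0 < 1 - alpha by lra.
have e t : powR (t.+1%:R : R) (- alpha) = t.+1%:R * powR t.+1%:R (- alpha - 1).
  rewrite -[X in X * _]powRr1 ?ler0n // -powRD ?pnatr_eq0 ?implybT //.
  by congr (powR _ _); ring.
have b1 t : bcoef alpha t.+1 <= (1 - alpha) / 12 * powR t.+1%:R (- alpha - 1).
  by apply: le_trans (bcoef_le t a0 a1) _; apply: ler_wpM2r; [exact: powR_ge0|nra].
have a_ge t : 2 * (1 - alpha) * powR t.+2%:R (- alpha - 1) <= acoef alpha t.+1.
  apply: le_trans (acoef_ge t a0 a1); rewrite e mulrA [2 * _]mulrC.
  by rewrite ler_wpM2r ?powR_ge0 // ler_pM2l // (ler_nat _ 2).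
have k9 t : (1 - alpha) * powR (t.+1%:R : R) (- alpha - 1)
    <= 9 * ((1 - alpha) * powR t.+3%:R (- alpha - 1)).
  by rewrite mulrCA ler_pM2l //; exact: powR_shift2_le.
have kmono t : (1 - alpha) * powR (t.+2%:R : R) (- alpha - 1)
    <= (1 - alpha) * powR t.+1%:R (- alpha - 1).
  by rewrite ler_pM2l //; apply: ler_powR_nexp; rewrite ?ltr0Sn ?ler_nat //; lra.
have P0 t : 0 <= (1 - alpha) * powR (t.+1%:R : R) (- alpha - 1).
  by rewrite mulr_ge0 ?powR_ge0 // ltW.
case: s => [|s] /=.
  by have := b1 0; have := a_ge 0; have := kmono 1; have := k9 0; have := P0 1; lra.
have := b1 s; have := b1 s.+1; have := a_ge s.+1.
by have := kmono s; have := k9 s; have := P0 s.+2; lra.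
Qed.

Lemma sum_dcoef_le (R : realType) (alpha : R) (m : nat) : 0 < alpha -> alpha < 1 ->
  \sum_(1 <= j < m.+1) dcoef alpha j <= powR m.+1%:R (1 - alpha).
Proof.
move=> a0 a1; case: m => [|m]; first by rewrite big_geq // powR_ge0.
(* Both the a's and the differences of b's telescope; the [- 1] then covers the last b. *)
have -> : \sum_(1 <= j < m.+2) dcoef alpha j
    = powR m.+2%:R (1 - alpha) - 1 + bcoef alpha m.+1.
  elim: m => [|m IH]; first by rewrite big_nat1 /= /acoef powR1.
  by rewrite big_nat_recr //= IH /acoef; ring.
have := bcoef_le m a0 a1.
have : powR (m.+1%:R : R) (- alpha - 1) <= powR 1 (- alpha - 1).
  by apply: ler_powR_nexp; rewrite ?(ler_nat _ 1) //; lra.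
rewrite powR1; have := powR_ge0 (m.+1%:R : R) (- alpha - 1).
set P := powR m.+1%:R (- alpha - 1) => P0 P1 B.
have : alpha * (1 - alpha) / 12 * P <= 1 by nra.
lra.
Qed.

Lemma sum_nat_delta (R : pzRingType) (n m : nat) (F : nat -> R) : (m < n)%N ->
  \sum_(0 <= s < n) (s == m)%:R * F s = F m.
Proof.
move=> mn; rewrite (bigD1_seq m) ?iota_uniq ?mem_index_iota //= eqxx mul1r.
by rewrite big1 ?addr0 // => s /negPf ->; rewrite mul0r.
Qed.

Lemma sum_ccoef (R : realType) (alpha : R) (j : nat) (delta : nat -> R) : alpha < 1 ->
  \sum_(0 <= s < j.+2) ccoef alpha j.+1 (j.+1 - s) * delta s
  = \sum_(0 <= s < j.+2) dcoef alpha (j.+1 - s) * delta s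
    + bcoef alpha 0 * (3 * delta j.+1 - delta j)
    + bcoef alpha j.+1 * (delta 1 - 2 * delta 0).
Proof.
move=> a1; rewrite -(@sum_nat_delta _ j.+2 j.+1 delta) // -(@sum_nat_delta _ j.+2 j delta) //.
rewrite -(@sum_nat_delta _ j.+2 1 delta) // -(@sum_nat_delta _ j.+2 0 delta) //.
rewrite !mulrBr !mulr_sumr -!sumrB -!big_split.
apply: eq_big_nat => s /andP[_ sj]; rewrite ccoef_dcoef ?leq_subr //.
have -> : (j.+1 - s == 0)%N = (s == j.+1) by lia.
have -> : (j.+1 - s == 1)%N = (s == j) by lia.
have -> : (j.+1 - s == j)%N = (s == 1) by lia.
have -> : (j.+1 - s == j.+1)%N = (s == 0) by lia.
by rewrite /=; ring.
Qed.

(** * Energy inequality for the L2 sum in time *)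

Section Energy.
Context (R : realFieldType) (d b w : nat -> R).
Hypothesis b_ge0 : forall s, 0 <= b s.+1.
Hypothesis d_diff : forall s, b s.+2 <= d s - d s.+1.
Hypothesis d_ge : forall s, 2 * b s.+1 <= d s.+1.

Lemma summation_by_parts (D z : nat -> R) (n : nat) :
  \sum_(0 <= s < n.+1) D s * (z s - z s.+1)
  = D 0 * z 0 - D n * z n.+1 + \sum_(0 <= s < n) (D s.+1 - D s) * z s.+1.
Proof.
elim: n => [|n IH]; first by rewrite big_nat1 big_geq //; ring.
by rewrite big_nat_recr //= IH [in RHS]big_nat_recr //=; ring.
Qed.

Definition kernel_energy (n : nat) : R :=
  2^-1 * \sum_(0 <= s < n.+1) d (n - s) * w s.+1 ^+ 2.

Lemma kernel_ge0 (s : nat) : 0 <= d s.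
Proof.
have := b_ge0; have := d_diff; have := d_ge => H1 H2 H3.
have d1 t : 0 <= d t.+1 by have := H1 t; have := H3 t; lra.
case: s => // ; have := H2 0; have := H3 1; have := d1 0; lra.
Qed.

Lemma kernel_energy_ge0 (n : nat) : 0 <= kernel_energy n.
Proof.
rewrite mulr_ge0 ?invr_ge0 ?ler0n // sumr_ge0 // => s _.
by rewrite mulr_ge0 ?kernel_ge0 // sqr_ge0.
Qed.

Lemma kernel_energy_step (j : nat) :
  kernel_energy j.+1 - kernel_energy j - 3 / 4 * d j.+1 * (w 0 ^+ 2 + w 1 ^+ 2)
  <= (\sum_(0 <= s < j.+2) d (j.+1 - s) * (w s.+1 - w s)
      + b j.+1 * (w 2 - w 1 - 2 * (w 1 - w 0))) * w j.+2.
Proof.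
set X := w j.+2; pose z s := (X - w s) ^+ 2.
(* Polarization: [2 (w_(s+1) - w_s) X] equals [w_(s+1)^2 - w_s^2 + (X - w_s)^2 - (X - w_(s+1))^2].
   The first difference yields the energies after a shift of index. *)
have E : (\sum_(0 <= s < j.+2) d (j.+1 - s) * (w s.+1 - w s)) * X
    = kernel_energy j.+1 - kernel_energy j - 2^-1 * (d j.+1 * w 0 ^+ 2)
      + 2^-1 * \sum_(0 <= s < j.+2) d (j.+1 - s) * (z s - z s.+1).
  have -> : kernel_energy j = 2^-1 * \sum_(0 <= s < j.+2) d (j.+1 - s) * w s ^+ 2
      - 2^-1 * (d j.+1 * w 0 ^+ 2).
    rewrite [in RHS]big_nat_recl // subn0 /kernel_energy mulrDr addrC addKr.
    by congr (_ * _); apply: eq_bigr => s _; rewrite subSS.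
  have cancel (x y u v : R) : x - (y - u) - u + v = x - y + v by ring.
  rewrite cancel /kernel_energy -!mulrBr -mulrDr -sumrB -big_split /=.
  rewrite mulr_suml mulr_sumr; by apply: eq_bigr => s _; rewrite /z; field.
rewrite [leRHS]mulrDl E summation_by_parts subn0 {2}/z subrr expr0n mulr0 subr0.
have zge s : 0 <= z s by exact: sqr_ge0.
have term s : (s < j.+1)%N -> 0 <= (d (j.+1 - s.+1) - d (j.+1 - s)) * z s.+1.
  move=> sj; rewrite mulr_ge0 // subSS subSn //.
  by have := d_diff (j - s); have := b_ge0 (j - s).+1; lra.
(* Only the term [s = 1] is kept. For [j = 0] there is no such term, but then [X = w 2] and
   [z 2 = 0]. *)
have S : b j.+1 * z 2 <= \sum_(0 <= s < j.+1) (d (j.+1 - s.+1) - d (j.+1 - s)) * z s.+1.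
  have [j0|j0] := ltnP 0 j; last first.
    have {}j0 : j = 0 by lia.
    have z2 : z 2 = 0 by rewrite /z /X j0 subrr expr0n.
    by have := term 0 isT; rewrite z2 mulr0 j0 big_nat1.
  rewrite big_ltn // big_ltn //; have := term 0 isT.
  have : 0 <= \sum_(2 <= s < j.+1) (d (j.+1 - s.+1) - d (j.+1 - s)) * z s.+1.
    by rewrite big_nat_cond sumr_ge0 // => s; rewrite andbT => /andP[_ sj]; exact: term.
  have : b j.+1 * z 2 <= (d (j.+1 - 2) - d (j.+1 - 1)) * z 2.
    rewrite ler_wpM2r // subSS subn1 subSS subn0.
    by case: (j) j0 => // i _; exact: d_diff.
  lra.
have b0 := b_ge0 j; have db : 2 * b j.+1 * z 0 <= d j.+1 * z 0 by rewrite ler_wpM2r.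
have dw0 : 2 * b j.+1 * w 0 ^+ 2 <= d j.+1 * w 0 ^+ 2 by rewrite ler_wpM2r ?sqr_ge0.
have dw1 : 2 * b j.+1 * w 1 ^+ 2 <= d j.+1 * w 1 ^+ 2 by rewrite ler_wpM2r ?sqr_ge0.
have d0 : 0 <= d j.+1 * w 0 ^+ 2 by rewrite mulr_ge0 ?kernel_ge0 ?sqr_ge0.
have sq : 0 <= b j.+1 * (3 / 2 * (X - w 1) ^+ 2 + w 0 ^+ 2 + 2^-1 * w 2 ^+ 2).
  apply: mulr_ge0 => //; have := sqr_ge0 (X - w 1).
  by have := sqr_ge0 (w 0); have := sqr_ge0 (w 2); lra.
move: S db sq; rewrite /z => S db sq.
(* The squares are chosen so that [X^2] cancels: [(X - w 0)^2] and [(X - w 2)^2] are absorbed by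
   [db] and [S], and [w 1 ^+ 2] by the allowance 3/4. *)
have -> : (b j.+1 * (w 2 - w 1 - 2 * (w 1 - w 0))) * X
  = b j.+1 * (3 / 2 * (X - w 1) ^+ 2 + w 0 ^+ 2 + 2^-1 * w 2 ^+ 2)
    - b j.+1 * (X - w 0) ^+ 2 - 2^-1 * (b j.+1 * (X - w 2) ^+ 2)
    - 3 / 2 * (b j.+1 * w 1 ^+ 2) by field.
lra.
Qed.

End Energy.

(** Up to scaling, the G-norm of Dahlquist for the two-step backward differentiation formula. *)
Definition bdf2_energy (R : realFieldType) (w : nat -> R) (j : nat) : R :=
  2^-1 * (w j.+1 ^+ 2 + (2 * w j.+1 - w j) ^+ 2).

Lemma bdf2_energy_step (R : realFieldType) (w : nat -> R) (j : nat) :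
  bdf2_energy w j.+1 - bdf2_energy w j
  <= (3 * (w j.+2 - w j.+1) - (w j.+1 - w j)) * w j.+2.
Proof.
rewrite /bdf2_energy -subr_ge0; set x := w j.+2; set y := w j.+1; set t := w j.
have -> : (3 * (x - y) - (y - t)) * x - (2^-1 * (x ^+ 2 + (2 * x - y) ^+ 2)
  - 2^-1 * (y ^+ 2 + (2 * y - t) ^+ 2)) = 2^-1 * (x - 2 * y + t) ^+ 2 by field.
by rewrite mulr_ge0 ?sqr_ge0 ?invr_ge0.
Qed.

Local Arguments ccoef : simpl never.
Local Arguments dcoef : simpl never.

Lemma L2_sum_lower_bound (R : realType) (alpha : R) (M : nat) (w : nat -> R) :
  0 < alpha -> alpha < 1 ->
  - (4 * powR M.+1%:R (1 - alpha) * (w 0 ^+ 2 + w 1 ^+ 2))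
  <= \sum_(1 <= j < M.+1)
       (\sum_(0 <= s < j.+1) ccoef alpha j (j - s) * (w s.+1 - w s)) * w j.+1.
Proof.
move=> a0 a1.
have bg s : 0 <= bcoef alpha s.+1 by exact: bcoef_ge0.
have dd s : bcoef alpha s.+2 <= dcoef alpha s - dcoef alpha s.+1 by exact: dcoef_diff.
have dg s : 2 * bcoef alpha s.+1 <= dcoef alpha s.+1 by exact: dcoef_ge.
have B0 : 0 <= bcoef alpha 0 <= 2^-1.
  rewrite bcoef0 // divr_ge0 /=; try lra.
  by rewrite ler_pdivrMr; lra.
pose K n := kernel_energy (dcoef alpha) w n + bcoef alpha 0 * bdf2_energy w n.
set W := w 0 ^+ 2 + w 1 ^+ 2.
have W0 : 0 <= W by rewrite addr_ge0 ?sqr_ge0.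
have step j : K j.+1 - K j - 3 / 4 * dcoef alpha j.+1 * W
   <= (\sum_(0 <= s < j.+2) ccoef alpha j.+1 (j.+1 - s) * (w s.+1 - w s)) * w j.+2.
  rewrite (sum_ccoef _ (fun s => w s.+1 - w s)) //.
  have := kernel_energy_step w bg dd dg j; rewrite -/W => H.
  have : bcoef alpha 0 * (bdf2_energy w j.+1 - bdf2_energy w j)
     <= bcoef alpha 0 * ((3 * (w j.+2 - w j.+1) - (w j.+1 - w j)) * w j.+2).
    by apply: ler_wpM2l; [lra|exact: bdf2_energy_step].
  rewrite /K; set S := (\sum_(_ <= _ < _) _) in H *; move: H; lra.
have tele : K M - K 0 - 3 / 4 * (\sum_(1 <= j < M.+1) dcoef alpha j) * W
  <= \sum_(1 <= j < M.+1)
       (\sum_(0 <= s < j.+1) ccoef alpha j (j - s) * (w s.+1 - w s)) * w j.+1.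
  elim: M => [|M IH]; first by rewrite !big_geq // mulr0 mul0r subr0 subrr.
  by rewrite !(@big_nat_recr _ _ _ M.+1 1) //=; have := step M; lra.
have KM : 0 <= K M.
  rewrite addr_ge0 ?(kernel_energy_ge0 w bg dd dg) // mulr_ge0 //; first lra.
  by rewrite mulr_ge0 ?invr_ge0 // addr_ge0 // sqr_ge0.
have K0 : K 0 <= 3 * W.
  rewrite /K /kernel_energy big_nat1 subn0 /bdf2_energy -[dcoef alpha 0]/(1 - 2 * bcoef alpha 0) /W.
  have : bcoef alpha 0 * (2^-1 * (w 1 ^+ 2 + (2 * w 1 - w 0) ^+ 2))
     <= 2^-1 * (2^-1 * (w 1 ^+ 2 + (2 * w 1 - w 0) ^+ 2)).
    by rewrite ler_wpM2r ?mulr_ge0 ?invr_ge0 ?addr_ge0 ?sqr_ge0 //; lra.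
  have : (1 - 2 * bcoef alpha 0) * w 1 ^+ 2 <= 1 * w 1 ^+ 2.
    by rewrite ler_wpM2r ?sqr_ge0 //; lra.
  have := sqr_ge0 (2 * w 1 + w 0); have := sqr_ge0 (w 0); have := sqr_ge0 (w 1).
  lra.
have S := sum_dcoef_le M a0 a1.
have SW : (\sum_(1 <= j < M.+1) dcoef alpha j) * W <= powR M.+1%:R (1 - alpha) * W.
  by rewrite ler_wpM2r.
(* The total cost is [3 W] from [K 0] plus 3/4 of the power times [W]; as the power is at least 1,
   the factor 4 suffices. *)
have P1 : 1 <= powR M.+1%:R (1 - alpha) :> R.
  rewrite -[leLHS](powRr0 M.+1%:R); apply: ler_powR; last lra.
  by rewrite (ler_nat _ 1).
have PW : 1 * W <= powR M.+1%:R (1 - alpha) * W by rewrite ler_wpM2r.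
apply: le_trans tele; lra.
Qed.

(** * Signs of Gamma and the norms, and spatial estimates for the compact operator *)

Lemma Gamma_ge0 (R : realType) (x : R) : 0 <= Gamma x.
Proof.
apply: fine_ge0; apply: integral_ge0 => t _.
by rewrite lee_fin mulr_ge0 ?powR_ge0 ?expR_ge0.
Qed.

Lemma norm0sq_ge0 (R : realType) (N : nat) (h : R) (v : nat -> R) :
  0 <= h -> 0 <= norm0sq N h v.
Proof. by move=> h0; rewrite sumr_ge0 // => i _; rewrite mulr_ge0 ?sqr_ge0. Qed.

Lemma norm0bsq_ge0 (R : realType) (N : nat) (h : R) (v : nat -> R) :
  0 <= h -> 0 <= norm0bsq N h v.
Proof. by move=> h0; rewrite sumr_ge0 // => i _; rewrite mulr_ge0 ?sqr_ge0. Qed.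

(** Summation by parts turns [-(y_xx, y)] into [|y_x|^2], and the correction [h^2/12 |y_xx|^2] costs
    at most a third of it; the induction does both at once. *)
Lemma dxx_dot_Hh_le (R : realType) (N : nat) (h : R) (v : nat -> R) :
  (0 < N)%N -> 0 < h -> v 0 = 0 -> v N = 0 ->
  \sum_(1 <= i < N) dxx h v i * Hh h v i * h <= - (2 / 3) * norm0bsq N h (dxb h v).
Proof.
case: N => // n _ h0 v0 vn.
(* The term [h / 6 * dxb h v m.+1 ^+ 2] pays for the second half of
   [(dxb v i.+1 - dxb v i)^2 <= 2 (dxb v i.+1 ^ 2 + dxb v i ^ 2)] at the next step. *)
have ind m : \sum_(1 <= i < m.+1) dxx h v i * Hh h v i * h
    <= dxb h v m.+1 * v m.+1 - 2 / 3 * norm0bsq m.+1 h (dxb h v)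
       - h / 6 * dxb h v m.+1 ^+ 2.
  elim: m => [|m IH].
    rewrite big_geq // /norm0bsq big_nat1.
    have -> : v 1 = h * dxb h v 1 by rewrite /dxb v0; field; lra.
    have := sqr_ge0 (dxb h v 1); nra.
  rewrite big_nat_recr //=; apply: le_trans (lerD IH (lexx _)) _.
  rewrite /norm0bsq (@big_nat_recr _ _ _ m.+2) //=.
  set S := \sum_(_ <= _ < _) _; set D := dxb h v m.+1; set D' := dxb h v m.+2.
  have -> : dxx h v m.+1 = (D' - D) / h by rewrite /dxx /D /D' /dxb /=; field; lra.
  have -> : Hh h v m.+1 = v m.+1 + h / 12 * (D' - D).
    by rewrite /Hh /dxx /D /D' /dxb /=; field; lra.
  have -> : v m.+2 = v m.+1 + h * D' by rewrite /D' /dxb /=; field; lra.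
  rewrite -subr_ge0.
  set e := (X in 0 <= X); have -> : e = h / 12 * (D' + D) ^+ 2 by rewrite /e; field; lra.
  by rewrite mulr_ge0 ?sqr_ge0 //; lra.
apply: le_trans (ind n) _; rewrite vn mulr0.
by have := mulr_ge0 (ltW h0) (sqr_ge0 (dxb h v n.+1)); lra.
Qed.

(** Cauchy-Schwarz for [v i] written as the sum of its increments [h * dxb h v], carried out one
    increment at a time. *)
Lemma discrete_poincare (R : realType) (N i : nat) (h : R) (v : nat -> R) :
  0 < h -> v 0 = 0 -> (i <= N)%N -> v i ^+ 2 <= N%:R * h * norm0bsq N h (dxb h v).
Proof.
move=> h0 v0.
have ind m : v m ^+ 2 <= m%:R * h * norm0bsq m h (dxb h v).
  elim: m => [|m IH]; first by rewrite v0 expr0n !mul0r.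
  rewrite /norm0bsq big_nat_recr //= -/(norm0bsq m h (dxb h v)).
  have := norm0bsq_ge0 m (dxb h v) (ltW h0).
  set S := norm0bsq _ _ _ in IH *; set D := dxb h v m.+1 => S0.
  have -> : v m.+1 = v m + h * D by rewrite /D /dxb /=; field; lra.
  rewrite -natr1; have := ler0n R m; move: (m%:R : R) IH => c IH c0.
  (* After squaring, the induction hypothesis reduces this to [4 S (c h D^2) <= (S + c h D^2)^2]. *)
  have cross : 2 * (v m * D) <= S + c * h * D ^+ 2.
    have p0 : 0 <= c * h * D ^+ 2 by rewrite mulr_ge0 ?sqr_ge0 ?mulr_ge0 ?(ltW h0).
    apply: le_trans (ler_norm _) _.
    rewrite -(@ler_pXn2r _ 2) ?nnegrE ?addr_ge0 // real_normK ?num_real //.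
    have : v m ^+ 2 * D ^+ 2 <= c * h * S * D ^+ 2 by rewrite ler_wpM2r ?sqr_ge0.
    have := sqr_ge0 (S - c * h * D ^+ 2).
    rewrite !expr2; lra.
  have : h * (2 * (v m * D)) <= h * (S + c * h * D ^+ 2) by rewrite ler_pM2l.
  rewrite !expr2 in IH *; lra.
move=> iN; apply: le_trans (ind i) _.
apply: ler_pM; rewrite ?mulr_ge0 ?norm0bsq_ge0 ?(ltW h0) //.
  by rewrite ler_pM2r // ler_nat.
rewrite /norm0bsq [leRHS](@big_cat_nat _ _ _ i.+1) //= lerDl sumr_ge0 // => s _.
by rewrite mulr_ge0 ?sqr_ge0 // ltW.
Qed.

(** [Hh] averages three neighbours with weights 1/12, 10/12, 1/12, so the pointwise bound survives;
    summing it over the nodes gives the second factor [N h]. *)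
Lemma norm0sq_Hh_le (R : realType) (N : nat) (h : R) (v : nat -> R) :
  0 < h -> v 0 = 0 ->
  norm0sq N h (Hh h v) <= (N%:R * h) ^+ 2 * norm0bsq N h (dxb h v).
Proof.
move=> h0 v0; set B := N%:R * h * norm0bsq N h (dxb h v).
have B0 : 0 <= B by rewrite !mulr_ge0 ?norm0bsq_ge0 ?(ltW h0).
have P i : (i <= N)%N -> v i ^+ 2 <= B by exact: discrete_poincare.
have -> : (N%:R * h) ^+ 2 * norm0bsq N h (dxb h v) = N%:R * (B * h) by rewrite /B; ring.
have HB i : (1 <= i < N)%N -> Hh h v i ^+ 2 * h <= B * h.
  case: i => // i /andP[_ iN]; rewrite ler_pM2r //.
  have -> : Hh h v i.+1 = (v i + 10 * v i.+1 + v i.+2) / 12.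
    by rewrite /Hh /dxx /=; field; lra.
  have := P i ltac:(lia); have := P i.+1 ltac:(lia); have := P i.+2 ltac:(lia).
  have := sqr_ge0 (v i - v i.+1); have := sqr_ge0 (v i.+1 - v i.+2).
  have := sqr_ge0 (v i - v i.+2); rewrite !expr2; lra.
rewrite /norm0sq big_nat_cond; apply: le_trans (ler_sum _ _) _.
  by move=> i; rewrite andbT; exact: HB.
rewrite -big_nat_cond sumr_const_nat -[leLHS]mulr_natl.
by apply: ler_wpM2r; [exact: mulr_ge0 B0 (ltW h0)|rewrite ler_nat leq_subr].
Qed.

(** * The a priori estimate for the scheme *)

Theorem theorem2 (R : realType) (alpha l T c1 : R) (k q : R -> R) :
  0 < alpha -> alpha < 1 -> 0 < l -> 0 < T -> 0 < c1 ->
  (forall t, 0 <= t <= T -> c1 <= k t) ->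
  (forall t, 0 <= t <= T -> 0 <= q t) ->
  exists M2 : R, 0 < M2 /\
  forall (N M : nat) (u0 : R -> R) (phi y : nat -> nat -> R),
    (2 <= N)%N -> (2 <= M)%N ->
    let h := l / N%:R in
    let tau := T / M%:R in
    (* the compact scheme, i = 1..N-1, j = 1..M-1 *)
    (forall i j, (1 <= i < N)%N -> (1 <= j < M)%N ->
       L2op alpha tau (fun s => Hh h (y s)) j i
       = k (j.+1%:R * tau) * dxx h (y j.+1) i
         - q (j.+1%:R * tau) * Hh h (y j.+1) i
         + Hh h (phi j.+1) i) ->
    (* boundary conditions *)
    (forall j, (j <= M)%N -> y j 0%N = 0 /\ y j N = 0) ->
    (* initial condition *)
    (forall i, (i <= N)%N -> y 0%N i = u0 (i%:R * h)) ->
    \sum_(1 <= j < M)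
       (norm0sq N h (Hh h (y j.+1)) + norm0bsq N h (dxb h (y j.+1))) * tau
    <= M2 * (norm0sq N h (Hh h (y 1%N)) + norm0sq N h (Hh h (y 0%N))
             + \sum_(1 <= j < M) norm0sq N h (Hh h (phi j.+1)) * tau).
Proof.
move=> a0 a1 l0 T0 c0 kc q0.
pose g := (Gamma (2 - alpha))^-1.
have g0 : 0 <= g by rewrite invr_ge0 Gamma_ge0.
(* [C1] is the constant of [L2_sum_lower_bound] after scaling by [tau]; [C2] is [1 / (4 eps)] for
   the Young parameter [eps] below. *)
pose C1 := 4 * g * powR T (1 - alpha); pose C2 := 3 * l ^+ 2 / (4 * c1).
have C10 : 0 <= C1 by rewrite !mulr_ge0 ?powR_ge0.
have C20 : 0 < C2 by rewrite divr_gt0 ?mulr_gt0 ?exprn_gt0.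
(* The factor [3 / c1] inverts the coefficient in [energy]; [1 + l^2] bounds both norms on the left
   by [|y_x|^2]. *)
pose K := (1 + l ^+ 2) * (3 / c1).
have K0 : 0 < K by rewrite mulr_gt0 ?divr_gt0 // addr_gt0 // exprn_gt0.
exists (K * (C1 + C2)); split; first by rewrite mulr_gt0 //; lra.
move=> N M u0 phi y N2 M2 h tau scheme bnd _.
have N0 : 0 < N%:R :> R by rewrite ltr0n ltnW.
have M0 : 0 < M%:R :> R by rewrite ltr0n ltnW.
have h0 : 0 < h by rewrite divr_gt0.
have tau0 : 0 < tau by rewrite divr_gt0.
have Nh : N%:R * h = l by rewrite /h; field; lra.
pose V j := Hh h (y j).
pose S j i := \sum_(0 <= s < j.+1) ccoef alpha j (j - s) * (V s.+1 i - V s i).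
pose nb j := norm0bsq N h (dxb h (y j.+1)).
pose I := norm0sq N h (V 1%N) + norm0sq N h (V 0%N).
have I0 : 0 <= I by rewrite addr_ge0 ?norm0sq_ge0 ?(ltW h0).
have Vnb j : (j < M)%N -> norm0sq N h (V j.+1) <= l ^+ 2 * nb j.
  by move=> jM; rewrite -Nh; apply: norm0sq_Hh_le => //; case: (bnd j.+1 jM).
have dot j : (1 <= j < M)%N -> \sum_(1 <= i < N) L2op alpha tau V j i * V j.+1 i * h
    <= - (c1 / 3) * nb j + C2 * norm0sq N h (Hh h (phi j.+1)).
  move=> j1; have jM : (j.+1 <= M)%N by case/andP: j1.
  have t01 : 0 <= j.+1%:R * tau <= T.
    rewrite mulr_ge0 ?(ltW tau0) //= /tau mulrCA ger_pMr //.
    by rewrite ler_pdivrMr // mul1r ler_nat.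
  have kj := kc _ t01; have qj := q0 _ t01; have [y0 yN] := bnd _ jM.
  move: (k _) (q _) (scheme^~ j) kj qj => kt qt scheme_j kj qj.
  (* With this choice [eps |H y|^2 <= c1/3 |y_x|^2], half of the dissipation [2/3 c1 |y_x|^2]. *)
  pose eps := c1 / (3 * l ^+ 2).
  have eps0 : 0 < eps by rewrite divr_gt0 ?mulr_gt0 ?exprn_gt0.
  have young (a b : R) : a * b <= eps * b ^+ 2 + C2 * a ^+ 2.
    rewrite -subr_ge0.
    have -> : eps * b ^+ 2 + C2 * a ^+ 2 - a * b = eps * (b - a / (2 * eps)) ^+ 2.
      by rewrite /C2 /eps; field; lra.
    by rewrite mulr_ge0 ?sqr_ge0 // ltW.
  have : \sum_(1 <= i < N) L2op alpha tau V j i * V j.+1 i * h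
     <= kt * (\sum_(1 <= i < N) dxx h (y j.+1) i * V j.+1 i * h)
        + eps * norm0sq N h (V j.+1) + C2 * norm0sq N h (Hh h (phi j.+1)).
    rewrite /norm0sq !mulr_sumr -!big_split /= big_nat_cond [leRHS]big_nat_cond.
    apply: ler_sum => i; rewrite andbT => i1; rewrite scheme_j // -/(V j.+1 i).
    have := ler_wpM2r (ltW h0) (young (Hh h (phi j.+1) i) (V j.+1 i)).
    have := mulr_ge0 (mulr_ge0 qj (sqr_ge0 (V j.+1 i))) (ltW h0).
    lra.
  have D := dxx_dot_Hh_le (ltnW N2) h0 y0 yN.
  have nb0 : 0 <= nb j by rewrite norm0bsq_ge0 // ltW.
  have k1 : kt * (\sum_(1 <= i < N) dxx h (y j.+1) i * V j.+1 i * h)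
     <= - (2 / 3) * (c1 * nb j).
    apply: le_trans (ler_wpM2l _ D) _; first by lra.
    have : c1 * nb j <= kt * nb j by rewrite ler_wpM2r.
    by rewrite /nb; lra.
  have e1 : eps * norm0sq N h (V j.+1) <= c1 / 3 * nb j.
    apply: le_trans (ler_wpM2l (ltW eps0) (Vnb j jM)) _.
    by rewrite le_eqVlt; apply/orP; left; apply/eqP; rewrite /eps; field; lra.
  lra.
have low : - (C1 * I) <= \sum_(1 <= j < M) (\sum_(1 <= i < N) L2op alpha tau V j i * V j.+1 i * h) * tau.
  have -> : \sum_(1 <= j < M) (\sum_(1 <= i < N) L2op alpha tau V j i * V j.+1 i * h) * tau
     = powR tau (1 - alpha) * g
       * (\sum_(1 <= i < N) (\sum_(1 <= j < M) S j i * V j.+1 i) * h).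
    rewrite [RHS]mulr_sumr; under [RHS]eq_bigr do rewrite mulr_suml mulr_sumr.
    rewrite exchange_big /=; apply: eq_bigr => j _; rewrite mulr_suml.
    apply: eq_bigr => i _; rewrite /L2op -/(S j i) -/g.
    have -> : powR tau (1 - alpha) = tau * powR tau (- alpha).
      have nz : tau != 0 by rewrite gt_eqF.
      by rewrite powRD ?nz ?implybT // powRr1 // ltW.
    ring.
  have -> : - (C1 * I) = powR tau (1 - alpha) * g
     * \sum_(1 <= i < N) - (4 * powR M%:R (1 - alpha) * (V 0 i ^+ 2 + V 1 i ^+ 2)) * h.
    have -> : C1 = 4 * g * (powR tau (1 - alpha) * powR M%:R (1 - alpha)).
      rewrite /C1 -powRM ?(ltW tau0) ?ler0n //; congr (_ * powR _ _).
      by rewrite /tau; field; lra.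
    rewrite /I /norm0sq -big_split /= -!mulNr !mulr_sumr; apply: eq_bigr => i _; ring.
  apply: ler_wpM2l; first by rewrite mulr_ge0 ?powR_ge0.
  apply: ler_sum => i _; rewrite ler_wpM2r ?(ltW h0) //.
  (* The time bound sums over layers 1 to [m], so it applies with [M = m.+1]. *)
  case: (M) M2 => // m _; exact: (L2_sum_lower_bound m (fun s => V s i)).
set F := \sum_(1 <= j < M) norm0sq N h (Hh h (phi j.+1)) * tau.
have F0 : 0 <= F.
  by rewrite sumr_ge0 // => j _; rewrite mulr_ge0 ?norm0sq_ge0 ?(ltW h0) ?(ltW tau0).
have B0 : 0 <= \sum_(1 <= j < M) nb j * tau.
  by rewrite sumr_ge0 // => j _; rewrite mulr_ge0 ?norm0bsq_ge0 ?(ltW h0) ?(ltW tau0).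
have energy : c1 / 3 * (\sum_(1 <= j < M) nb j * tau) <= C1 * I + C2 * F.
  have : \sum_(1 <= j < M) (\sum_(1 <= i < N) L2op alpha tau V j i * V j.+1 i * h) * tau
     <= - (c1 / 3) * (\sum_(1 <= j < M) nb j * tau) + C2 * F.
    rewrite /F !mulr_sumr -big_split /= big_nat_cond [leRHS]big_nat_cond.
    apply: ler_sum => j; rewrite andbT => j1.
    by have := ler_wpM2r (ltW tau0) (dot j j1); lra.
  lra.
have -> : K * (C1 + C2) * (norm0sq N h (Hh h (y 1)) + norm0sq N h (Hh h (y 0)) + F)
   = K * ((C1 + C2) * (I + F)) by rewrite /I mulrA.
apply: (@le_trans _ _ ((1 + l ^+ 2) * (\sum_(1 <= j < M) nb j * tau))).
  rewrite mulr_sumr big_nat_cond [leRHS]big_nat_cond; apply: ler_sum => j.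
  rewrite andbT => /andP[_ jM]; rewrite mulrA ler_pM2r //.
  by have := Vnb j jM; rewrite /nb /V; lra.
rewrite /K -mulrA; apply: ler_wpM2l; first by rewrite addr_ge0 ?sqr_ge0.
rewrite -(@ler_pM2l _ (c1 / 3)) ?divr_gt0 //; apply: le_trans energy _.
have -> : c1 / 3 * (3 / c1 * ((C1 + C2) * (I + F))) = (C1 + C2) * (I + F) by field; lra.
have := mulr_ge0 C10 F0; have := mulr_ge0 (ltW C20) I0; lra.
Qed.
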